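(* Let $h(x)$ be a polynomial with real coefficients, let $A$ be an arbitrary $(m+1)$-dimensional unitary algebra over $K$ ($K=\mathbb{R}$ or $\mathbb{C}$) with basis $\{e_0,e_1,\dots,e_m\}$, and let $Q_{h,n}(x)=\sum_{k=0}^{m}F_{h,n+k}(x)\,e_k$ ($n\ge 0$) be the $h(x)$-Fibonacci polynomials in $A$. Then for nonnegative integers $n,r$ with $r\le n$, $$Q_{h,n+r}(x)\,Q_{h,n-r}(x)-Q_{h,n}^{2}(x)=\frac{(-1)^{n+r+1}}{h^{2}(x)+4}\Bigl(\alpha^{\ast}(x)\beta^{\ast}(x)\bigl[(-1)^{r+1}+\alpha^{2r}(x)\bigr]+\beta^{\ast}(x)\alpha^{\ast}(x)\bigl[(-1)^{r+1}+\beta^{2r}(x)\bigr]\Bigr).$$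
   Context: The real $h(x)$-Fibonacci polynomials $F_{h,n}(x)$ are defined by $F_{h,0}(x)=0$, $F_{h,1}(x)=1$ and $F_{h,n}(x)=h(x)F_{h,n-1}(x)+F_{h,n-2}(x)$ for $n\ge 2$. The scalars $$\alpha(x)=\frac{h(x)+\sqrt{h^{2}(x)+4}}{2},\qquad \beta(x)=\frac{h(x)-\sqrt{h^{2}(x)+4}}{2}$$ are the roots of $v^{2}-h(x)v-1=0$, and $\alpha^{\ast}(x)=\sum_{k=0}^{m}\alpha^{k}(x)\,e_k\in A$, $\beta^{\ast}(x)=\sum_{k=0}^{m}\beta^{k}(x)\,e_k\in A$. Powers such as $\alpha^k(x)$ mean $(\alpha(x))^k$, and $Q_{h,n}^2(x)=Q_{h,n}(x)Q_{h,n}(x)$, products of elements of $A$ being taken in $A$. The variable $x$ is real. The algebra $A$ has a unit and a $K$-bilinear product; it is not assumed associative or commutative. *)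

(* Defs.v *)
From HB Require Import structures.
From mathcomp Require Import all_boot all_order all_algebra.
From mathcomp Require Import sesquilinear complex reals.

Set Implicit Arguments.
Unset Strict Implicit.
Unset Printing Implicit Defensive.

Import Order.TTheory GRing.Theory Num.Theory.
Local Open Scope ring_scope.

(* K ranges over exactly two fields: R and R[i]. *)
Variant base_field := RealBase | ComplexBase.

Definition scalars (R : realType) (b : base_field) : fieldType :=
  match b with
  | RealBase => R : fieldType
  | ComplexBase => R[i] : fieldType
  end.

(* The inclusion of the real numbers in K. *)
Definition of_real (R : realType) (b : base_field) :
    {rmorphism R -> scalars R b} :=
  match b return {rmorphism R -> scalars R b} with
  | RealBase => idfun : {rmorphism R -> R}
  | ComplexBase => real_complex R : {rmorphism R -> R[i]}
  end.
Arguments of_real {R b}.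

Fixpoint hfib (R : realType) (h : {poly R}) (n : nat) : {poly R} :=
  match n with
  | 0 => 0
  | S n1 => match n1 with
            | 0 => 1
            | S n2 => h * hfib h n1 + hfib h n2
            end
  end.

Definition hfib_alg (R : realType) (b : base_field) (A : vectType (scalars R b))
    (m : nat) (e : m.+1.-tuple A) (h : {poly R}) (n : nat) (x : R) : A :=
  \sum_(k < m.+1) of_real (hfib h (n + k)).[x] *: tnth e k.

Definition alpha (R : realType) (h : {poly R}) (x : R) : R :=
  (h.[x] + Num.sqrt (h.[x] ^+ 2 + 4)) / 2.

Definition beta (R : realType) (h : {poly R}) (x : R) : R :=
  (h.[x] - Num.sqrt (h.[x] ^+ 2 + 4)) / 2.

Definition alpha_star (R : realType) (b : base_field)
    (A : vectType (scalars R b)) (m : nat) (e : m.+1.-tuple A)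
    (h : {poly R}) (x : R) : A :=
  \sum_(k < m.+1) of_real (alpha h x ^+ k) *: tnth e k.

Definition beta_star (R : realType) (b : base_field)
    (A : vectType (scalars R b)) (m : nat) (e : m.+1.-tuple A)
    (h : {poly R}) (x : R) : A :=
  \sum_(k < m.+1) of_real (beta h x ^+ k) *: tnth e k.

(* Main.v *)
(* By Binet's formula (alpha - beta) Q_n = alpha^n alpha* - beta^n beta*.
   Expanding both products bilinearly, the alpha* alpha* and beta* beta* terms
   cancel, and alpha beta = -1 and (alpha - beta)^2 = h^2 + 4 evaluate the
   coefficients of the two mixed terms, which stay separate since the product
   need not commute. *)
Require Import Defs.
From HB Require Import structures.
From mathcomp Require Import all_boot all_order all_algebra.
From mathcomp Require Import sesquilinear complex reals.
From mathcomp Require Import ring lra zify.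

Set Implicit Arguments.
Unset Strict Implicit.
Unset Printing Implicit Defensive.

Import Order.TTheory GRing.Theory Num.Theory.
Local Open Scope ring_scope.

Lemma discriminant_gt0 (R : realType) (h : {poly R}) (x : R) :
  0 < h.[x] ^+ 2 + 4.
Proof. by rewrite ltr_wpDl ?sqr_ge0. Qed.

Lemma alphaB_beta (R : realType) (h : {poly R}) (x : R) :
  alpha h x - beta h x = Num.sqrt (h.[x] ^+ 2 + 4).
Proof. by rewrite /alpha /beta; field. Qed.

Lemma sqr_alphaB_beta (R : realType) (h : {poly R}) (x : R) :
  (alpha h x - beta h x) ^+ 2 = h.[x] ^+ 2 + 4.
Proof. by rewrite alphaB_beta sqr_sqrtr // ltW ?discriminant_gt0. Qed.

Lemma alphaB_beta_neq0 (R : realType) (h : {poly R}) (x : R) :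
  alpha h x - beta h x != 0.
Proof. by rewrite -sqrf_eq0 sqr_alphaB_beta gt_eqF ?discriminant_gt0. Qed.

Lemma alphaD_beta (R : realType) (h : {poly R}) (x : R) :
  alpha h x + beta h x = h.[x].
Proof. by rewrite /alpha /beta; field. Qed.

Lemma alphaM_beta (R : realType) (h : {poly R}) (x : R) :
  alpha h x * beta h x = -1.
Proof.
(* The two squares $(\alpha-\beta)^2$ and $(\alpha+\beta)^2+4$ agree; comparing them is linear in
   the monomials and leaves $4\alpha\beta=-4$. *)
have := sqr_alphaB_beta h x; rewrite -alphaD_beta => eqD.
by lra.
Qed.

(** Both sides satisfy the recurrence of [hfib] with the same initial values. Keeping the factor
    $\alpha-\beta$ on the left avoids division in the induction. *)
Lemma hfib_binet (R : realType) (h : {poly R}) (x : R) (n : nat) :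
  (alpha h x - beta h x) * (hfib h n).[x] = alpha h x ^+ n - beta h x ^+ n.
Proof.
(* The recurrence has order two, so the induction carries two consecutive indices. *)
suff: (alpha h x - beta h x) * (hfib h n).[x] = alpha h x ^+ n - beta h x ^+ n
   /\ (alpha h x - beta h x) * (hfib h n.+1).[x]
        = alpha h x ^+ n.+1 - beta h x ^+ n.+1 by case.
elim: n => [|n [IHn IHn1]]; first by rewrite /= !hornerE subrr.
split=> //; rewrite [hfib h n.+2]/= hornerD hornerM -/(hfib h n.+1).
rewrite mulrDr mulrCA IHn1 IHn -alphaD_beta !exprS.
have := alphaM_beta h x; set a := alpha h x; set c := beta h x => acN1.
have -> : a * (a * a ^+ n) - c * (c * c ^+ n)
  = (a + c) * (a * a ^+ n - c * c ^+ n) - (a * c) * (a ^+ n - c ^+ n) by ring.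
by rewrite acN1 mulN1r opprK.
Qed.

(** Binet's formula holds on each coordinate; splitting $\alpha^{n+k}=\alpha^n\alpha^k$ lets
    $\alpha^n$ leave the sum, and likewise for $\beta$. *)
Lemma hfib_alg_binet (R : realType) (b : base_field)
    (A : vectType (scalars R b)) (m : nat) (e : m.+1.-tuple A)
    (h : {poly R}) (n : nat) (x : R) :
  hfib_alg e h n x
  = of_real (alpha h x - beta h x)^-1 *:
      (of_real (alpha h x ^+ n) *: alpha_star e h x
       - of_real (beta h x ^+ n) *: beta_star e h x).
Proof.
rewrite /hfib_alg /alpha_star /beta_star !scaler_sumr -sumrB scaler_sumr.
apply: eq_bigr => k _; rewrite !scalerA -scalerBl scalerA -!rmorphM -rmorphB.
rewrite -rmorphM -!exprD -hfib_binet mulKf //; exact: alphaB_beta_neq0.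
Qed.

Lemma bilinear_catalan (K : fieldType) (A : lmodType K)
    (mul : {bilinear A -> A -> A}) (u v : A) (d a1 b1 a2 b2 a b : K) :
  a1 * a2 = a ^+ 2 -> b1 * b2 = b ^+ 2 ->
  mul (d *: (a1 *: u - b1 *: v)) (d *: (a2 *: u - b2 *: v))
    - mul (d *: (a *: u - b *: v)) (d *: (a *: u - b *: v))
  = d ^+ 2 *: ((a * b - a1 * b2) *: mul u v + (a * b - b1 * a2) *: mul v u).
Proof.
move=> eqa eqb.
have expand s t s' t' :
  mul (d *: (s *: u - t *: v)) (d *: (s' *: u - t' *: v))
  = d ^+ 2 *: ((s * s') *: mul u u + (t * t') *: mul v v
               - ((s * t') *: mul u v + (t * s') *: mul v u)).
  rewrite linearZl_LR linearZr_LR scalerA -expr2; congr (_ *: _).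
  rewrite linearBl !linearBr !linearZl_LR !linearZr_LR !scalerA.
  by rewrite opprB opprD [LHS]addrACA.
(* By [eqa] and [eqb] both products have the same [mul u u] and [mul v v] terms, which cancel. *)
rewrite !expand -scalerBr eqa eqb -!expr2; congr (_ *: _).
rewrite opprB addrC addrA subrK opprD addrACA [b * a]mulrC.
by rewrite -!scalerBl.
Qed.

(** Stated for any [s], [t] with product $-1$, so that it serves both mixed terms, with the two
    roots exchanged in the second. *)
Lemma catalan_exponents (K : comPzRingType) (s t : K) (n r : nat) :
  s * t = -1 -> (r <= n)%N ->
  s ^+ n * t ^+ n - s ^+ (n + r) * t ^+ (n - r)
  = (-1) ^+ (n + r + 1) * ((-1) ^+ (r + 1) + s ^+ (2 * r)).
Proof.
(* Writing $n=k+r$ removes the truncated subtraction. *)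
move=> stN1 /subnK <-; move: (n - r)%N => k; rewrite addnK.
have -> : s ^+ (k + r + r) * t ^+ k = (s * t) ^+ k * s ^+ (2 * r).
  by rewrite mul2n -addnn -addnA exprD exprMn mulrAC.
rewrite -exprMn stN1 mulrDr -exprD.
(* Even summands are isolated in the exponents of $-1$, leaving the signs $(-1)^{k+r}$ and
   $(-1)^{k+1}$. *)
have -> : (k + r + r + 1 + (r + 1) = k + r + (r + 1) * 2)%N by lia.
have -> : (k + r + r + 1 = k + r * 2 + 1)%N by lia.
by rewrite !exprD !exprM !sqrr_sign; ring.
Qed.

Theorem theorem3p8 (R : realType) (b : base_field) (m : nat)
    (A : vectType (scalars R b)) (mul : {bilinear A -> A -> A}) (one : A)
    (mul1a : left_id one mul) (mula1 : right_id one mul)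
    (e : m.+1.-tuple A) (e_basis : basis_of fullv e)
    (h : {poly R}) (n r : nat) (le_rn : (r <= n)%N) (x : R) :
  mul (hfib_alg e h (n + r) x) (hfib_alg e h (n - r) x)
    - mul (hfib_alg e h n x) (hfib_alg e h n x)
  = of_real ((-1) ^+ (n + r + 1) / (h.[x] ^+ 2 + 4)) *:
      (of_real ((-1) ^+ (r + 1) + alpha h x ^+ (2 * r)) *:
         mul (alpha_star e h x) (beta_star e h x)
       + of_real ((-1) ^+ (r + 1) + beta h x ^+ (2 * r)) *:
         mul (beta_star e h x) (alpha_star e h x)).
Proof.
have betaM_alpha : beta h x * alpha h x = -1 by rewrite mulrC alphaM_beta.
have sqr_pow (c : R) : c ^+ (n + r) * c ^+ (n - r) = (c ^+ n) ^+ 2.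
  by rewrite -exprD -exprM; congr (_ ^+ _); lia.
rewrite !hfib_alg_binet.
rewrite (bilinear_catalan _ _ _ _ _ (a := of_real (alpha h x ^+ n))
  (b := of_real (beta h x ^+ n))); first last.
- by rewrite -rmorphM sqr_pow rmorphXn.
- by rewrite -rmorphM sqr_pow rmorphXn.
rewrite -!rmorphM -!rmorphB catalan_exponents ?alphaM_beta //.
(* Commuting the scalars turns the coefficient of $\beta^*\alpha^*$ into the same expression with
   $\alpha$ and $\beta$ swapped. *)
rewrite [alpha h x ^+ n * _]mulrC catalan_exponents //.
rewrite -rmorphXn exprVn sqr_alphaB_beta.
rewrite !(rmorphM _ ((-1) ^+ (n + r + 1))) -!scalerA -scalerDr scalerA.
by rewrite mulrC -scalerA.
Qed.
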